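(* Let $A,B,C,D$ be finite sets and let $\lambda \in \mathrm{Exch}^\times(2^A, 2^B)$, $\mu \in \mathrm{Exch}^\times(2^B, 2^C)$, $\nu \in \mathrm{Exch}^\times(2^C, 2^D)$. Then: (i) $\lambda \bullet \mu$ has a definite type, and hence $\lambda \bullet \mu \in \mathrm{Exch}^\times(2^A, 2^C)$. (ii) $(\lambda \bullet \mu) \bullet \nu = \lambda \bullet (\mu \bullet \nu)$. (iii) Types are additive under association: in $\mathbb{Z}\times\mathbb{Z}$, $$\langle \lambda \bullet \mu : \nu\rangle + \langle\lambda:\mu\rangle = \langle\mu:\nu\rangle + \langle\lambda : \mu \bullet \nu\rangle .$$
   Context: For a finite set $E$, $2^E$ is the set of subsets of $E$. Complements $\overline X$ are taken in the ambient set. $A\sqcup B$ is the disjoint union, and subsets of $A\sqcup B$ are identified with pairs of subsets of $A$ and $B$. $\mathrm{Rel}(2^A,2^B)$ is the set of all binary relations $\lambda \subseteq 2^A\times 2^B$; $X\mapsto_\lambda Y$ means $(X,Y)\in\lambda$; $0_{AB}$ is the empty relation. Given $X\mapsto_\lambda Y$ and $u,v\in A\sqcup B$, say $u$ and $v$ are exchangeable in $X\mapsto_\lambda Y$ if either $u=v$, or exactly one of $u,v$ belongs to $\overline X\sqcup Y$ and $X'\mapsto_\lambda Y'$, where $X' = X\,\triangle\,(\{u,v\}\cap A)$ and $Y'=Y\,\triangle\,(\{u,v\}\cap B)$. $\mathrm{Exch}(2^A,2^B)$ is the set of $\lambda\in\mathrm{Rel}(2^A,2^B)$ satisfying the exchange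 axiom: for all $X\mapsto_\lambda Y$, $X'\mapsto_\lambda Y'$ and all $u\in\overline X\sqcup Y$ there exists $v\in\overline{X'}\sqcup Y'$ such that $u,v$ are exchangeable in $X\mapsto_\lambda Y$. (Equivalently, $\{\overline X\sqcup Y : X\mapsto_\lambda Y\}$ is empty or the set of bases of a matroid on $A\sqcup B$.) $\mathrm{Exch}^\times(2^A,2^B)=\mathrm{Exch}(2^A,2^B)\setminus\{0_{AB}\}$. Lax composition. Let $\lambda\in\mathrm{Rel}(2^A,2^B)$, $\mu\in\mathrm{Rel}(2^B,2^C)$ be non-empty relations. For $m\ge 0$, $X\mapsto_{\lambda\bullet_m\mu}Z$ iff there exist $Y,Y'\subseteq B$ with $X\mapsto_\lambda Y'$, $Y\mapsto_\mu Z$, $|Y\triangle Y'|=m$. Let $m_0$ be the smallest $m\geq 0$ with $\lambda\bullet_m\mu\neq 0_{AC}$, and define $\lambda\bullet\mu:=\lambda\bullet_{m_0}\mu$. For $k,l\ge0$, $X\mapsto_{\lambda\bullet_{k,l}\mu}Z$ iff there exist $Y,Y'\subseteq B$ with $X\mapsto_\lambda Y'$, $Y\mapsto_\mu Z$, $|Y\setminus Y'|=k$, $|Y'\setminus Y|=l$. One says $\lambda\bullet\mu$ has a definite type if there is a unique pair $(k_0,l_0)$ of non-negative integers with $k_0+l_0=m_0$ and $\lambda\bullet_{k_0,l_0}\mu\ne0_{AC}$; this pair is then the type of $\lambda\bullet\mu$, denoted $\langle\lambda:\mu\rangle:=(k_0,l_0)$. *)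

(* Defs.v *)
From mathcomp Require Import all_boot all_order all_algebra.

Set Implicit Arguments.
Unset Strict Implicit.
Unset Printing Implicit Defensive.

(* Relations are finite sets of pairs of finite sets, so that equality of
   relations is extensional; the disjoint union of A and B is A + B. *)
Notation Rel A B := {set {set A} * {set B}}.

Definition symdiff (T : finType) (X Y : {set T}) : {set T} :=
  (X :\: Y) :|: (Y :\: X).

Section Exchange.
Variables A B : finType.
Implicit Types (lambda : Rel A B) (X : {set A}) (Y : {set B}) (u v : A + B).

(* The subset of A + B made of the complement of X and of Y. *)
Definition base_of X Y : {set A + B} := (inl @: ~: X) :|: (inr @: Y).

Definition exchangeable lambda X Y u v : bool :=
  (u == v) ||
  ((u \in base_of X Y) (+) (v \in base_of X Y)) &&
  ((symdiff X (inl @^-1: [set u; v]), symdiff Y (inr @^-1: [set u; v]))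
     \in lambda).

Definition exchange_axiom lambda : bool :=
  [forall p in lambda, forall q in lambda,
     forall u in base_of p.1 p.2, exists v in base_of q.1 q.2,
       exchangeable lambda p.1 p.2 u v].

Definition Exch : {set Rel A B} := [set lambda | exchange_axiom lambda].

Definition Exch_nz : {set Rel A B} := Exch :\ set0.

End Exchange.

Arguments Exch : clear implicits.
Arguments Exch_nz : clear implicits.

Section LaxComposition.
Variables A B C : finType.
Implicit Types (lambda : Rel A B) (mu : Rel B C).

Definition comp_at (m : nat) lambda mu : Rel A C :=
  [set p | [exists Y : {set B}, exists Y' : {set B},
     [&& (p.1, Y') \in lambda, (Y, p.2) \in mu & #|symdiff Y Y'| == m]]].

Definition comp_kl (k l : nat) lambda mu : Rel A C :=
  [set p | [exists Y : {set B}, exists Y' : {set B},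
     [&& (p.1, Y') \in lambda, (Y, p.2) \in mu,
         #|Y :\: Y'| == k & #|Y' :\: Y| == l]]].

(* As |symdiff Y Y'| <= #|B|, the search for the least m can be bounded; see
   lax_degreeP.  If lambda or mu is empty the value is the junk #|B|. *)
Definition lax_degree lambda mu : nat :=
  [arg min_(m < ord_max : 'I_#|B|.+1 | comp_at m lambda mu != set0) m].

Definition lax_comp lambda mu : Rel A C :=
  comp_at (lax_degree lambda mu) lambda mu.

Definition is_type lambda mu (t : nat * nat) : Prop :=
  (t.1 + t.2)%N = lax_degree lambda mu /\ comp_kl t.1 t.2 lambda mu <> set0.

Definition has_definite_type lambda mu : Prop :=
  exists! t : nat * nat, is_type lambda mu t.

(* Meaningful when the type is definite, see lax_typeP; junk otherwise. *)
Definition lax_type lambda mu : nat * nat :=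
  let m0 := lax_degree lambda mu in
  if [pick k : 'I_m0.+1 | comp_kl k (m0 - k) lambda mu != set0] is Some k
  then (k : nat, m0 - k)%N else (0, 0)%N.

Lemma lax_degreeP lambda mu : lambda != set0 -> mu != set0 ->
  comp_at (lax_degree lambda mu) lambda mu != set0 /\
  forall m, comp_at m lambda mu != set0 -> lax_degree lambda mu <= m.
Proof.
case/set0Pn=> -[X Y'] lXY /set0Pn [[Y Z] mYZ].
have bnd m : comp_at m lambda mu != set0 -> m < #|B|.+1.
  case/set0Pn=> p; rewrite inE => /existsP[U /existsP[V /and3P[_ _ /eqP <-]]].
  by rewrite ltnS max_card.
have ne0 : comp_at #|symdiff Y Y'| lambda mu != set0.
  apply/set0Pn; exists (X, Z); rewrite inE.
  by apply/existsP; exists Y; apply/existsP; exists Y'; rewrite lXY mYZ eqxx.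
pose P := fun m : 'I_#|B|.+1 => comp_at m lambda mu != set0.
have [i0 Pi0 min_i0] : exists2 i, P i & forall j, P j -> i <= j.
  by case: (@arg_minnP _ (Ordinal (bnd _ ne0)) P (fun m => m) ne0) => i;
     exists i.
have -> : lax_degree lambda mu = i0.
  rewrite /lax_degree /arg_min /extremum.
  case: pickP => [j /andP[Pj /forallP minj] | /(_ i0)] /=.
    apply/eqP; rewrite eqn_leq min_i0 // andbT.
    by have /implyP/(_ Pi0) := minj i0.
  rewrite -[comp_at _ _ _ != _]/(P i0) Pi0 => /negP[]; apply/forallP=> j.
  exact/implyP/min_i0.
by split=> // m nem; exact: (min_i0 (Ordinal (bnd m nem))).
Qed.

Lemma lax_typeP lambda mu :
  has_definite_type lambda mu -> is_type lambda mu (lax_type lambda mu).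
Proof.
case=> -[k l] [[/= kl ne0] _]; rewrite /lax_type.
case: pickP => [i nei | /(_ (Ordinal (_ : k < _)))] /=.
  by split=> /=; [rewrite subnKC // -ltnS | apply/eqP].
have lek : k < (lax_degree lambda mu).+1 by rewrite ltnS -kl leq_addr.
by move=> /(_ lek)/negbFE/eqP; rewrite -kl addKn.
Qed.

End LaxComposition.

Definition int_pair (t : nat * nat) : int * int := (Posz t.1, Posz t.2).

(* Main.v *)
Require Import Defs.
From mathcomp Require Import all_boot all_order all_algebra zify.

(* View a relation as the family of sets ~X + Y inside one ground set E
   containing A, B, C and D; the exchange axiom says that these are the bases
   of a matroid.  A pair (X, Y') in lambda, (Y, Z) in mu gives a member of the
   matroid union of the two matroids, which leaves exactly Y :\: Y' of B
   uncovered and covers exactly Y' :\: Y twice.  A basis of the union that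
   contains a maximal independent subset of B minimizes both cardinals
   simultaneously, whence the definite type, and lambda . mu is the contraction
   of the union by B.  Associativity and additivity of types then follow since
   contraction by B commutes with union by a matroid supported off B, and since
   successive contractions by B and by C amount to contraction by B + C. *)

Set Implicit Arguments.
Unset Strict Implicit.
Unset Printing Implicit Defensive.

(** * Matroids as families of independent sets: rank, extension, union, contraction *)

Section Matroids.
Variable E : finType.
Implicit Types (F I J : {set {set E}}) (K L P Q X Y Z : {set E}).

Definition matroid I : Prop :=
  [/\ set0 \in I, forall X Y, X \subset Y -> Y \in I -> X \in I
    & forall X Y, X \in I -> Y \in I -> #|X| < #|Y| ->
        exists2 e, e \in Y :\: X & e |: X \in I].

Definition exchange F : Prop := forall P Q u, P \in F -> Q \in F ->
  u \in P :\: Q -> exists2 v, v \in Q :\: P & v |: (P :\ u) \in F.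

Definition rank I K := \max_(X : {set E} | (X \in I) && (X \subset K)) #|X|.

Definition bases I := [set X in I | #|X| == rank I setT].

Definition indep F := [set X : {set E} | [exists P in F, X \subset P]].

(** The independent sets of the matroid union; [X] and [Y] may overlap, which is what the second
    entry of a type will measure. *)
Definition join I J := [set X :|: Y | X in I, Y in J].

(** The contracted matroid keeps [E] as ground set, the elements of [K] becoming loops. One basis
    [Y] of [K] is asked for; by [contract_mono] any other would do. *)
Definition contract I K :=
  [set X : {set E} | [disjoint X & K] &
     [exists Y : {set E} in I,
        [&& Y \subset K, #|Y| == rank I K & X :|: Y \in I]]].

Lemma card_disjointU X Y : [disjoint X & Y] -> #|X :|: Y| = #|X| + #|Y|.
Proof. by move=> dXY; rewrite -cardsUI (disjoint_setI0 dXY) cards0 addn0. Qed.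

Lemma disjoint_setU X Y Z :
  [disjoint X :|: Y & Z] = [disjoint X & Z] && [disjoint Y & Z].
Proof. by rewrite -!setI_eq0 setIUl setU_eq0. Qed.

Lemma disjoint_setD X K : [disjoint X :\: K & K].
Proof. by rewrite -setI_eq0 setDE -setIA (setIC (~: K)) setICr setI0. Qed.

Lemma indepP F X : reflect (exists2 P, P \in F & X \subset P) (X \in indep F).
Proof. by rewrite inE; apply: exists_inP. Qed.

Lemma contractP I K X :
  reflect ([disjoint X & K] /\
    exists Y, [/\ Y \in I, Y \subset K, #|Y| = rank I K & X :|: Y \in I])
  (X \in contract I K).
Proof.
rewrite inE; apply: (iffP andP) => -[dXK].
  by case/exists_inP=> Y YI /and3P[YK /eqP rY XYI]; split=> //; exists Y.
case=> Y [YI YK rY XYI]; split=> //; apply/exists_inP; exists Y => //.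
by rewrite YK rY eqxx.
Qed.

Lemma rank_ge I K X : X \in I -> X \subset K -> #|X| <= rank I K.
Proof.
move=> XI XK; rewrite /rank.
by rewrite (@leq_bigmax_cond _ _ (fun X : {set E} => #|X|)) // XI XK.
Qed.

Lemma rank_attained I K : matroid I ->
  exists X, [/\ X \in I, X \subset K & #|X| = rank I K].
Proof.
case=> I0 _ _; rewrite /rank.
have : 0 < #|[pred X | (X \in I) && (X \subset K)]|.
  by apply/card_gt0P; exists set0; rewrite inE I0 sub0set.
case/(eq_bigmax_cond (fun X : {set E} => #|X|)) => X.
by rewrite inE => /andP[XI XK] ->; exists X.
Qed.

Lemma matroid_extend I X Y : matroid I -> X \in I -> Y \in I -> #|X| <= #|Y| ->
  exists Z, [/\ Z \in I, X \subset Z, Z \subset X :|: Y & #|Z| = #|Y|].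
Proof.
case=> _ _ aug + YI; have [n] := ubnP (#|Y| - #|X|).
elim: n X => // n IHn X; rewrite ltnS => Dn XI.
rewrite leq_eqVlt => /predU1P[eqXY | ltXY].
  by exists X; rewrite subsetUl.
have [e /setDP[eY eX] eXI] := aug _ _ XI YI ltXY.
have ce : #|e |: X| = #|X|.+1 by rewrite cardsU1 eX.
case: (IHn (e |: X)) => //; try lia.
move=> Z [ZI sZ Zs cZ]; exists Z; split=> //.
  exact: subset_trans (subsetUr _ _) sZ.
apply: subset_trans Zs _; apply/subsetP=> x.
rewrite !inE -orbA => /or3P[/eqP-> | -> | ->];
  by rewrite ?eY ?orbT.
Qed.

Lemma rank_extend I K X : matroid I -> X \in I -> X \subset K ->
  exists Z, [/\ Z \in I, X \subset Z, Z \subset K & #|Z| = rank I K].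
Proof.
move=> mI XI XK; have [Y [YI YK rY]] := rank_attained K mI.
have [|Z [ZI XZ ZXY cZ]] := matroid_extend mI XI YI.
  by rewrite rY rank_ge.
exists Z; split=> //; last by rewrite cZ.
by apply: subset_trans ZXY _; rewrite subUset XK YK.
Qed.

(** * Basis exchange against the independence axioms *)

(** Exchanging an element of [P :\: Q] keeps the cardinal of [P] and shrinks [P :\: Q]. Once [P] is
    inside [Q] they are equal, since an element of [Q :\: P] would need a partner in the empty
    [P :\: Q]. *)
Lemma exchange_card F : exchange F ->
  forall P Q, P \in F -> Q \in F -> #|P| = #|Q|.
Proof.
move=> exF P Q + QF; have [n] := ubnP #|P :\: Q|.
elim: n P => // n IHn P; rewrite ltnS => Dn PF.
have [PQ0 | [u uPQ]] := set_0Vmem (P :\: Q).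
  have /eqP := PQ0; rewrite setD_eq0 => sPQ.
  have [QP0 | [v vQP]] := set_0Vmem (Q :\: P).
    by have /eqP := QP0; rewrite setD_eq0 => sQP;
       apply/eqP; rewrite eqn_leq !subset_leq_card.
  by case: (exF _ _ _ QF PF vQP) => w; rewrite PQ0 inE.
have [v vQP P'F] := exF _ _ _ PF QF uPQ.
case/setDP: (uPQ) => uP uQ; case/setDP: (vQP) => vQ vP.
have vu : v != u by apply: contraNneq uQ => <-.
have <- : #|v |: P :\ u| = #|P|.
  by rewrite cardsU1 !inE (negPf vP) andbF (cardsD1 u P) uP.
apply: IHn => //; apply: leq_trans Dn; apply: proper_card; apply/properP; split.
  apply/subsetP=> x; rewrite !inE => /andP[xQ /orP[/eqP Dx|/andP[_ ->]]].
    by rewrite Dx vQ in xQ.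
  by rewrite xQ.
by exists u => //; rewrite !inE uQ eqxx /= orbF eq_sym.
Qed.

(** The elements of [P] outside [X :|: Q] are exchanged one by one for elements of [Q]; those of [X]
    are never removed. *)
Lemma exchange_extend F X P Q : exchange F -> P \in F -> Q \in F ->
  X \subset P -> exists R, [/\ R \in F, X \subset R & R \subset X :|: Q].
Proof.
move=> exF.
have [n] := ubnP #|P :\: (X :|: Q)|.
elim: n P => // n IHn P; rewrite ltnS => Dn PF QF XP.
have [/eqP | [u]] := set_0Vmem (P :\: (X :|: Q)).
  by rewrite setD_eq0 => sP; exists P.
rewrite !inE negb_or -andbA => /and3P[uX uQ uP].
have [|v /setDP[vQ vP] P'F] := exF _ _ u PF QF; first by rewrite inE uQ.
apply: IHn P'F QF _; last first.
  apply/subsetP=> x xX; rewrite !inE (subsetP XP) // andbT.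
  by apply/orP; right; apply: contraNneq uX => <-.
apply: leq_trans Dn; apply: proper_card; apply/properP; split.
  apply/subsetP=> x; rewrite !inE => /andP[xQ /orP[/eqP Dx|/andP[_ ->]]].
    by rewrite Dx vQ orbT in xQ.
  by rewrite xQ.
exists u; rewrite !inE ?negb_or ?uX ?uQ ?uP // eqxx /= orbF eq_sym.
by apply: contraNneq uQ => <-.
Qed.

Lemma matroid_indep F : F != set0 -> exchange F -> matroid (indep F).
Proof.
case/set0Pn=> P0 P0F exF; split.
- by apply/indepP; exists P0; rewrite ?sub0set.
- move=> X Y sXY /indepP[P PF sYP]; apply/indepP; exists P => //.
  exact: subset_trans sXY sYP.
move=> X Y /indepP[P PF sXP] /indepP[Q QF sYQ] ltXY.
(* Any element of [R] in [Y :\: X] augments [X]. Were there none, [R] would lie in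
   [X :|: (Q :\: Y)], which has fewer than [#|Q|] elements because [#|X| < #|Y|]. *)
have [R [RF sXR sR]] := exchange_extend exF PF QF sXP.
have [/eqP R0 | [e]] := set_0Vmem (R :&: (Y :\: X)); last first.
  rewrite inE => /andP[eR eYX]; exists e => //; apply/indepP; exists R => //.
  by rewrite subUset sub1set eR.
have : R \subset X :|: (Q :\: Y).
  apply/subsetP=> x xR; have := subsetP sR _ xR; rewrite !inE.
  case xX: (x \in X) => //= ->; rewrite andbT.
  by have /eqP/setP/(_ x) := R0; rewrite !inE xR xX /= => ->.
move/subset_leq_card; rewrite (exchange_card exF RF QF).
have := (leq_card_setU X (Q :\: Y)).1; rewrite cardsD (setIidPr sYQ).
have := subset_leq_card sYQ; lia.
Qed.

Lemma bases_indep F : exchange F -> bases (indep F) = F.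
Proof.
move=> exF.
have le_rk P : P \in F -> #|P| = rank (indep F) setT.
  move=> PF; apply/eqP; rewrite eqn_leq rank_ge ?subsetT //=; last first.
    by apply/indepP; exists P.
  apply/bigmax_leqP=> X /andP[/indepP[Q QF sXQ] _].
  by rewrite (exchange_card exF PF QF) subset_leq_card.
apply/setP=> X; apply/idP/idP; last first.
  move=> XF; rewrite inE le_rk // eqxx andbT; apply/indepP; by exists X.
rewrite inE => /andP[/indepP[Q QF sXQ]]; rewrite -(le_rk _ QF) => cX.
have -> // : X = Q.
by apply/eqP; rewrite eqEcard sXQ (eqP cX) /=.
Qed.

Lemma indep_bases I : matroid I -> indep (bases I) = I.
Proof.
move=> mI; case: (mI) => _ dn _; apply/setP=> X; apply/indepP/idP.
  by case=> P /setIdP[PI _] sXP; apply: dn sXP PI.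
move=> XI; have [Z [ZI XZ _ rZ]] := rank_extend mI XI (subsetT X).
by exists Z; rewrite // inE ZI rZ eqxx.
Qed.

Lemma bases_exchange I : matroid I -> exchange (bases I).
Proof.
move=> mI P Q u /setIdP[PI /eqP rP] /setIdP[QI /eqP rQ] /setDP[uP uQ].
case: (mI) => _ dn aug.
have cP : #|P :\ u|.+1 = #|P| by rewrite (cardsD1 u P) uP.
have [||v /setDP[vQ vP] vI] := aug (P :\ u) Q _ QI; [|lia|].
  exact: dn (subsetDl _ _) PI.
have vu : v != u by apply: contraNneq uQ => <-.
exists v; first by rewrite inE vQ andbT; move: vP; rewrite !inE vu.
by rewrite inE vI cardsU1 vP add1n cP rP eqxx.
Qed.

Lemma bases_neq0 I : matroid I -> bases I != set0.
Proof.
move=> mI; have [X [XI _ rX]] := rank_attained setT mI.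
by apply/set0Pn; exists X; rewrite inE XI rX eqxx.
Qed.

(** * Matroid union *)

Lemma joinC I J : join I J = join J I.
Proof.
by apply/setP=> X; apply/imset2P/imset2P=> -[P Q PI QI ->];
   exists Q P; rewrite // setUC.
Qed.

Lemma joinA I J F : join I (join J F) = join (join I J) F.
Proof.
apply/setP=> X; apply/imset2P/imset2P.
  case=> P _ PI /imset2P[Q R QJ RF ->] ->; exists (P :|: Q) R => //.
    exact: imset2_f.
  by rewrite setUA.
case=> _ R /imset2P[P Q PI QJ ->] RF ->; exists P (Q :|: R) => //.
  exact: imset2_f.
by rewrite setUA.
Qed.

(* If the element augmenting X1 from Y1 already lies in X2, moving it to X1
   brings the splitting X1 + X2 closer to the splitting Y1 + Y2. *)
Lemma join_augment I J X1 X2 Y1 Y2 : matroid I -> matroid J ->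
  X1 \in I -> X2 \in J -> Y1 \in I -> Y2 \in J -> [disjoint Y1 & Y2] ->
  #|X1| + #|X2| < #|Y1| + #|Y2| ->
  exists2 e, e \in (Y1 :|: Y2) :\: (X1 :|: X2) & e |: (X1 :|: X2) \in join I J.
Proof.
have [n] := ubnP (#|X1 :&: Y2| + #|X2 :&: Y1|).
elim: n I J X1 X2 Y1 Y2 => // n IHn I J X1 X2 Y1 Y2.
(* The total of the cardinals increases, so one of the two summands does; the statement is symmetric
   in the two matroids. *)
wlog ltXY1 : I J X1 X2 Y1 Y2 / #|X1| < #|Y1|.
  move=> W lt_n mI mJ X1I X2J Y1I Y2J dY ltXY.
  have [ltXY1 | leYX1] := ltnP #|X1| #|Y1|; first exact: W.
  rewrite joinC (setUC X1) (setUC Y1); apply: W => //; try lia.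
  by rewrite disjoint_sym.
rewrite ltnS => le_n mI mJ X1I X2J Y1I Y2J dY ltXY.
case: (mI) (mJ) => [_ _ aI] [_ dJ _].
have [e /setDP[eY1 eX1] eI] := aI _ _ X1I Y1I ltXY1.
have [eX2 | eX2] := boolP (e \in X2); last first.
  exists e; first by rewrite !inE eY1 (negPf eX1) (negPf eX2).
  by rewrite setUA; apply: imset2_f.
have eY2 : e \notin Y2 by move/pred0P/(_ e): dY => /=; rewrite eY1 /= => ->.
have DX : X1 :|: X2 = (e |: X1) :|: (X2 :\ e).
  by apply/setP=> x; rewrite !inE; case: eqP => //= ->; rewrite eX2 orbT.
rewrite DX; apply: IHn => //.
- apply: leq_trans le_n; rewrite -addnS leq_add //.
    rewrite subset_leq_card //; apply/subsetP=> x; rewrite !inE.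
    by case: eqP => //= ->; rewrite (negPf eY2) andbF.
  apply: proper_card; apply/properP; split.
    by apply: setSI; apply: subsetDl.
  by exists e; rewrite !inE ?eX2 ?eqxx.
- by apply: dJ X2J; apply: subsetDl.
by rewrite cardsU1 eX1 addnAC; move: ltXY; rewrite (cardsD1 e X2) eX2; lia.
Qed.

Lemma join_disjoint I J X : matroid J -> X \in join I J ->
  exists P Q, [/\ P \in I, Q \in J, [disjoint P & Q] & X = P :|: Q].
Proof.
case=> _ dJ _ /imset2P[P Q PI QJ ->]; exists P, (Q :\: P); split=> //.
- by apply: dJ QJ; apply: subsetDl.
- by rewrite disjoint_sym disjoint_setD.
by apply/setP=> x; rewrite !inE; case: (x \in P).
Qed.

Lemma matroid_join I J : matroid I -> matroid J -> matroid (join I J).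
Proof.
move=> mI mJ; case: (mI) (mJ) => [I0 dI _] [J0 dJ _]; split.
- by apply/imset2P; exists set0 set0; rewrite ?setU0.
- move=> X Y sXY /imset2P[P Q PI QJ DY]; apply/imset2P.
  exists (X :&: P) (X :&: Q).
  + exact: dI (subsetIr _ _) PI.
  + exact: dJ (subsetIr _ _) QJ.
  by rewrite -setIUr -DY; apply/esym/setIidPl.
move=> X Y /(join_disjoint mJ)[X1 [X2 [X1I X2J dX ->]]].
case/(join_disjoint mJ)=> [Y1 [Y2 [Y1I Y2J dY ->]]].
rewrite !card_disjointU // => ltXY.
by apply: join_augment.
Qed.

(** * Contraction, its ranks, and its commutation with union *)

(** In a subset of [K] independent in the union, the part coming from [J] is both inside [K] and
    disjoint from it, hence empty. *)
Lemma rank_join_off I J K : matroid J ->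
  (forall Y, Y \in J -> [disjoint Y & K]) ->
  rank (join I J) K = rank I K.
Proof.
case=> J0 _ _ offJ; apply/eqP; rewrite eqn_leq; apply/andP; split.
  apply/bigmax_leqP=> X /andP[/imset2P[P Q PI QJ ->]].
  rewrite subUset => /andP[PK QK].
  have -> : Q = set0.
    by rewrite -(disjoint_setI0 (offJ _ QJ)); apply/esym/setIidPl.
  by rewrite setU0 rank_ge.
apply/bigmax_leqP=> X /andP[XI XK]; rewrite rank_ge //.
by apply/imset2P; exists X set0; rewrite ?setU0.
Qed.

(** As [J] lives off [K], a basis of [K] in the union is one in [I], and it lies in the [I] part of
    every decomposition of a set containing it. So the [J] part can be split off before or after
    contracting. *)
Lemma contract_join I J K : matroid I -> matroid J ->
  (forall Y, Y \in J -> [disjoint Y & K]) ->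
  contract (join I J) K = join (contract I K) J.
Proof.
move=> mI mJ offJ; case: (mI) (mJ) => [I0 dI _] [J0 dJ _].
have offE Q x : Q \in J -> x \in K -> x \in Q = false.
  by move=> /offJ/pred0P/(_ x) /= + xK; rewrite xK andbT.
apply/setP=> X; apply/contractP/imset2P.
  case=> dX [Y [YIJ YK]]; rewrite rank_join_off // => rY.
  case/imset2P=> P Q PI QJ DXY; exists (P :\: Y) Q => //.
    apply/contractP; split.
      apply/pred0P=> x /=; apply/negP=> /andP[/setDP[xP xY] xK].
      have /setP/(_ x) := DXY; rewrite !inE xP (negPf xY) orbF /= => xX.
      by move/pred0P/(_ x): dX; rewrite /= xX xK.
    have YP : Y \subset P.
      apply/subsetP=> x xY; have /setP/(_ x) := DXY; rewrite !inE xY orbT.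
      by rewrite (offE Q x) ?orbF ?(subsetP YK).
    exists Y; split=> //; first exact: dI YP PI.
    have -> // : P :\: Y :|: Y = P.
    by apply/setP=> x; rewrite !inE; case xY: (x \in Y) => /=;
       rewrite ?orbF // (subsetP YP).
  apply/setP=> x; have /setP/(_ x) := DXY; rewrite !inE.
  case xY: (x \in Y) => /=; last by rewrite orbF.
  have xK := subsetP YK _ xY; rewrite (offE Q x) // => _.
  by move/pred0P/(_ x): dX; rewrite /= xK andbT.
case=> P Q /contractP[dP [Y [YI YK rY PYI]]] QJ ->; split.
  by rewrite disjoint_setU dP offJ.
exists Y; split=> //; last 1 first.
- by rewrite setUAC; apply: imset2_f.
- by apply/imset2P; exists Y set0; rewrite ?setU0.
by rewrite rank_join_off.
Qed.

(** Extend [Y] from [X :|: Y'], with [Y'] the basis of [K] given by the contraction. The result [Z]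
    meets [K] only in [Y], which is maximal there, so [Z] lies in [X :|: Y]; both have the same
    cardinal. *)
Lemma contract_mono I K X Y : matroid I -> X \in contract I K ->
  Y \in I -> Y \subset K -> #|Y| = rank I K -> X :|: Y \in I.
Proof.
move=> mI /contractP[dX [Y' [Y'I Y'K rY' XY'I]]] YI YK rY.
have cX (Z : {set E}) : Z \subset K -> #|X :|: Z| = #|X| + #|Z|.
  by move=> ZK; rewrite card_disjointU //; apply: disjointWr dX.
have [|Z [ZI YZ sZ cZ]] := matroid_extend mI YI XY'I.
  by rewrite cX // rY rY' leq_addl.
have ZKY : Z :&: K = Y.
  apply/esym/eqP; rewrite eqEcard subsetI YZ YK rY rank_ge ?subsetIr //.
  by case: mI => _ dI _; apply: dI ZI; apply: subsetIl.
have -> // : X :|: Y = Z.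
apply/esym/eqP; rewrite eqEcard cZ !cX // rY rY' leqnn andbT.
apply/subsetP=> x xZ; have := subsetP sZ _ xZ; rewrite !inE.
have /setP/(_ x) := ZKY; rewrite inE xZ /= => <-.
by case/or3P=> [-> | -> | /(subsetP Y'K) ->]; rewrite ?orbT.
Qed.

Lemma matroid_contract I K : matroid I -> matroid (contract I K).
Proof.
move=> mI; case: (mI) => I0 dI aI.
have [Y [YI YK rY]] := rank_attained K mI.
(* With one basis [Y] of [K] fixed for all [X], the axioms for the contraction are read off those of
   [I]. *)
have memP X : reflect ([disjoint X & K] /\ X :|: Y \in I) (X \in contract I K).
  apply: (iffP idP) => [XI | [dX XYI]].
    by split; [case/contractP: XI | apply: contract_mono rY].
  by apply/contractP; split=> //; exists Y.
split.
- by apply/memP; rewrite set0U -setI_eq0 set0I eqxx.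
- move=> X Z sXZ /memP[dZ ZYI]; apply/memP; split.
    exact: disjointWl sXZ dZ.
  by apply: dI ZYI; apply: setSU.
move=> X Z /memP[dX XYI] /memP[dZ ZYI] ltXZ.
have dY (W : {set E}) : [disjoint W & K] -> #|W :|: Y| = #|W| + #|Y|.
  by move=> dW; rewrite card_disjointU //; apply: disjointWr dW.
have [|e /setDP[]] := aI _ _ XYI ZYI; first by rewrite !dY // ltn_add2r.
rewrite !inE => + /norP[eX eY]; rewrite (negPf eY) orbF => eZ eI.
exists e; first by rewrite inE eX.
apply/memP; split; last by rewrite -setUA.
by rewrite disjoint_setU dX andbT; apply: disjointWl dZ; rewrite sub1set.
Qed.

(** One inequality adds a basis of [K] to a basis of [L] in the contraction; the other extends a
    basis of [K] to one of [K :|: L] and cuts it along [K]. *)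
Lemma rank_contract I K L : matroid I -> [disjoint L & K] ->
  rank (contract I K) L + rank I K = rank I (K :|: L).
Proof.
move=> mI dLK; apply/eqP; rewrite eqn_leq; apply/andP; split.
  have [X [XI XL <-]] := rank_attained L (matroid_contract K mI).
  case/contractP: (XI) => dX [Y [YI YK <- XYI]].
  rewrite -card_disjointU; last exact: disjointWr dX.
  by rewrite rank_ge // setUC setUSS.
have [Y [YI YK rY]] := rank_attained K mI.
have [|Z [ZI YZ ZKL <-]] := rank_extend (K := K :|: L) mI YI.
  by apply: subset_trans YK _; apply: subsetUl.
have ZI' : Z :\: K \in contract I K.
  apply/contractP; split; first exact: disjoint_setD.
  exists Y; split=> //; case: mI => _ dI _; apply: dI ZI.
  by rewrite subUset YZ subsetDl.
rewrite -(cardsID K Z) addnC leq_add //.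
  by rewrite rank_ge // subDset.
rewrite rank_ge ?subsetIr //.
by case: mI => _ dI _; apply: dI ZI; apply: subsetIl.
Qed.

Lemma contract_contract I K L : matroid I -> [disjoint L & K] ->
  contract (contract I K) L = contract I (K :|: L).
Proof.
move=> mI dLK; case: (mI) => I0 dI aI.
have mC := matroid_contract K mI.
have [Y [YI YK rY]] := rank_attained K mI.
apply/setP=> X; apply/contractP/contractP.
  case=> dX [Z [/contractP[dZ _] ZL rZ XZI]]; split.
    rewrite disjoint_sym disjoint_setU ![[disjoint _ & X]]disjoint_sym dX andbT.
    by case/contractP: XZI; rewrite disjoint_setU => /andP[].
  have XZYI := contract_mono mI XZI YI YK rY.
  exists (Z :|: Y); split; first by apply: dI XZYI; rewrite -setUA subsetUr.
  - by rewrite setUC setUSS.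
  - rewrite card_disjointU; last exact: disjointWr dZ.
    by rewrite rZ rY rank_contract.
  by rewrite setUA.
case=> dXKL WX; have XI : X \in contract I (K :|: L) by apply/contractP.
move: dXKL; rewrite disjoint_sym disjoint_setU ![[disjoint _ & X]]disjoint_sym.
case/andP=> dXK dXL; split=> //.
(* A basis of [K :|: L] chosen to contain the basis [Y] of [K]: its trace off [K] is then a basis of
   [L] in the contraction by [K]. *)
have [Z [ZI YZ ZKL rZ]] := rank_extend mI YI (subset_trans YK (subsetUl K L)).
have XZI := contract_mono mI XI ZI ZKL rZ.
have ZK : Z :&: K = Y.
  apply/esym/eqP; rewrite eqEcard subsetI YZ YK rY rank_ge ?subsetIr //.
  by apply: dI ZI; apply: subsetIl.
exists (Z :\: K); split.
- apply/contractP; split; first exact: disjoint_setD.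
  by exists Y; split=> //; apply: dI ZI; rewrite subUset YZ subsetDl.
- by rewrite subDset.
- apply: (@addnI #|Y|); rewrite -{1}ZK cardsID rZ -(rank_contract mI dLK) rY.
  exact: addnC.
apply/contractP; split; first by rewrite disjoint_setU dXK disjoint_setD.
exists Y; split=> //; apply: dI XZI; rewrite -setUA setUS //.
by rewrite subUset YZ subsetDl.
Qed.

(** Enlarging the two parts of [T] to bases cannot enlarge their union, which already has maximum
    cardinal. *)
Lemma bases_join I J T : matroid I -> matroid J ->
  T \in join I J -> #|T| = rank (join I J) setT ->
  exists P Q, [/\ P \in bases I, Q \in bases J & T = P :|: Q].
Proof.
move=> mI mJ /imset2P[P0 Q0 P0I Q0J DT] rT.
have [P [PI sP _ rP]] := rank_extend mI P0I (subsetT _).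
have [Q [QJ sQ _ rQ]] := rank_extend mJ Q0J (subsetT _).
exists P, Q; rewrite !inE PI QJ rP rQ !eqxx; split=> //.
apply/eqP; rewrite eqEcard {1}DT setUSS //= rT.
by rewrite rank_ge ?subsetT // imset2_f.
Qed.

Lemma rank_contractT I K : matroid I ->
  rank (contract I K) setT + rank I K = rank I setT.
Proof.
move=> mI; rewrite -(setUCr K) -(rank_contract mI); last first.
  by rewrite -setI_eq0 setIC setICr.
congr (_ + _); rewrite setUCr; apply: eq_bigl => X.
case XI: (X \in contract I K) => //=; rewrite subsetT -disjoints_subset.
by case/contractP: XI => ->.
Qed.

End Matroids.

(** * Encoding relations as families of subsets of a common ground set *)

Lemma symdiffE (T : finType) (X Y : {set T}) x :
  (x \in symdiff X Y) = (x \in X) (+) (x \in Y).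
Proof. by rewrite !inE; case: (x \in X); case: (x \in Y). Qed.

Lemma card_symdiff (S : finType) (X Y : {set S}) :
  #|symdiff X Y| = #|X :\: Y| + #|Y :\: X|.
Proof.
rewrite card_disjointU // -setI_eq0; apply/eqP/setP=> x; rewrite !inE.
by case: (x \in X); rewrite ?andbF.
Qed.

Section Encoding.
Variables A B E : finType.
Variables (f : A -> E) (g : B -> E).
Hypotheses (f_inj : injective f) (g_inj : injective g).
Hypothesis fg : forall a b, f a != g b.
Implicit Types (lambda : Rel A B) (X : {set A}) (Y : {set B}).

(** The image of [base_of X Y] in [E]. The injections are parameters so that relations sharing a set
    overlap on its copy in [E]. *)
Definition code X Y : {set E} := (f @: ~: X) :|: (g @: Y).

Definition enc lambda : {set {set E}} := [set code p.1 p.2 | p in lambda].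

Lemma base_of_inl X Y a : (inl a \in base_of X Y) = (a \notin X).
Proof.
rewrite inE mem_imset ?inE; last by move=> x y [].
by rewrite orbC; case: imsetP => // -[].
Qed.

Lemma base_of_inr X Y b : (inr b \in base_of X Y) = (b \in Y).
Proof.
rewrite inE (mem_imset Y); last by move=> x y [].
by case: imsetP => // -[].
Qed.

Lemma base_of_symdiff X Y u v :
  base_of (symdiff X (inl @^-1: [set u; v])) (symdiff Y (inr @^-1: [set u; v]))
  = symdiff (base_of X Y) [set u; v].
Proof.
apply/setP=> -[a | b]; rewrite symdiffE.
  by rewrite !base_of_inl symdiffE addNb inE.
by rewrite !base_of_inr symdiffE inE.
Qed.

Definition ground (s : A + B) : E := match s with inl a => f a | inr b => g b end.

Lemma ground_inj : injective ground.
Proof.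
move=> [a|b] [a'|b'] //= eq_fg;
  try by [congr inl; apply: f_inj | congr inr; apply: g_inj].
- by have := fg a b'; rewrite eq_fg eqxx.
- by have := fg a' b; rewrite eq_fg eqxx.
Qed.

Lemma codeE X Y : code X Y = ground @: base_of X Y.
Proof. by rewrite imsetU -!imset_comp. Qed.

Lemma base_of_inj X X' Y Y' : base_of X Y = base_of X' Y' -> X = X' /\ Y = Y'.
Proof.
move=> eqS; split; apply/setP=> x.
  by apply: negb_inj; rewrite -(base_of_inl X Y) eqS base_of_inl.
by rewrite -(base_of_inr X Y) eqS base_of_inr.
Qed.

Lemma code_inj X X' Y Y' : code X Y = code X' Y' -> X = X' /\ Y = Y'.
Proof. by rewrite !codeE => /(imset_inj ground_inj)/base_of_inj. Qed.

Lemma mem_enc lambda X Y : (code X Y \in enc lambda) = ((X, Y) \in lambda).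
Proof.
apply/imsetP/idP => [[[X' Y'] lXY /code_inj[-> ->]] // | lXY].
by exists (X, Y).
Qed.

Lemma encP lambda P :
  reflect (exists X Y, (X, Y) \in lambda /\ P = code X Y) (P \in enc lambda).
Proof.
apply: (iffP imsetP) => [[[X Y] lXY ->] | [X [Y [lXY ->]]]]; first by exists X, Y.
by exists (X, Y).
Qed.

Lemma enc_inj : injective enc.
Proof. by move=> l l' eql; apply/setP=> -[X Y]; rewrite -!mem_enc eql. Qed.

(** Complementing [X] commutes with toggling elements, so toggling [u] and [v] is an ordinary basis
    exchange on codes. *)
Lemma code_symdiff X Y u v : u \in base_of X Y -> v \notin base_of X Y ->
  code (symdiff X (inl @^-1: [set u; v])) (symdiff Y (inr @^-1: [set u; v]))
  = ground v |: (code X Y :\ ground u).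
Proof.
move=> uS vS; rewrite !codeE base_of_symdiff.
apply/setP=> x; apply/imsetP/setU1P.
  case=> s; rewrite symdiffE in_set2 => + ->.
  case: (s =P v) => [-> | _]; first by left.
  rewrite orbF => sS; right; rewrite in_setD1 (inj_eq ground_inj) mem_imset.
    by move: sS; case: (s =P u) => [->|]; rewrite ?uS ?addbF.
  exact: ground_inj.
case=> [-> | /setD1P[+ /imsetP[s sS Dx]]].
  by exists v; rewrite // symdiffE (negPf vS) in_set2 eqxx orbT.
rewrite Dx (inj_eq ground_inj) => su; exists s => //.
rewrite symdiffE sS in_set2 (negPf su) /=.
by apply: contraNneq vS => <-.
Qed.

Lemma enc_exchange lambda : exchange (enc lambda) <-> exchange_axiom lambda.
Proof.
have memg s (S : {set A + B}) : (ground s \in ground @: S) = (s \in S).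
  by rewrite mem_imset //; apply: ground_inj.
split=> [exl | /forall_inP exl].
  apply/forall_inP=> -[X Y] lp; apply/forall_inP=> -[X' Y'] lq.
  apply/forall_inP=> u /= uS; apply/exists_inP.
  (* If [u] lies in both sets then [v = u] is allowed; matroid exchange only concerns the remaining
     case. *)
  have [uS' | uS'] := boolP (u \in base_of X' Y').
    by exists u; rewrite // /exchangeable eqxx.
  rewrite -mem_enc in lp; rewrite -mem_enc in lq.
  case: (exl _ _ (ground u) lp lq); first by rewrite !codeE inE !memg uS uS'.
  move=> _ /setDP[/[!codeE]/imsetP[v vS' ->]]; rewrite memg -!codeE => vS.
  rewrite -code_symdiff // mem_enc => l'.
  by exists v; rewrite // /exchangeable uS (negPf vS) l' orbT.
move=> P Q w /encP[X [Y [lp ->]]] /encP[X' [Y' [lq ->]]] /setDP[].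
rewrite !codeE => /imsetP[u uS ->]; rewrite memg => uS'.
have /forall_inP/(_ _ lq)/forall_inP/(_ _ uS)/exists_inP[v /= vS'] := exl _ lp.
case/orP=> [/eqP Du | ]; first by rewrite Du vS' in uS'.
rewrite uS /= => /andP[vS l']; exists (ground v); last first.
  by rewrite -codeE -code_symdiff // mem_enc.
by rewrite inE !memg vS vS'.
Qed.

Lemma enc_neq0 lambda : (enc lambda != set0) = (lambda != set0).
Proof. by rewrite /enc imset_eq0. Qed.

Lemma Exch_nzE lambda :
  lambda \in Exch_nz A B <-> enc lambda != set0 /\ exchange (enc lambda).
Proof.
rewrite !inE enc_neq0; split; first by case/andP=> -> /enc_exchange.
by case=> -> /enc_exchange.
Qed.

Lemma indep_enc_off lambda P (K : {set E}) : P \in indep (enc lambda) ->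
  (forall a, f a \notin K) -> (forall b, g b \notin K) -> [disjoint P & K].
Proof.
case/indepP=> _ /encP[X [Y [_ ->]]] sP fK gK.
apply: disjointWl sP _; apply/pred0P=> x /=; apply/negP=> /andP[].
case/setUP=> /imsetP[y _ ->]; first by rewrite (negPf (fK _)).
by rewrite (negPf (gK _)).
Qed.

End Encoding.

(** * Lax composition as the contraction of a matroid union *)

Section LaxCompositionMatroid.
Variables A B C E : finType.
Variables (f : A -> E) (g : B -> E) (h : C -> E).
Hypotheses (f_inj : injective f) (g_inj : injective g) (h_inj : injective h).
Hypothesis fg : forall a b, f a != g b.
Hypothesis gh : forall b c, g b != h c.
Hypothesis fh : forall a c, f a != h c.
Variables (lambda : Rel A B) (mu : Rel B C).
Hypotheses (lambdaE : lambda \in Exch_nz A B) (muE : mu \in Exch_nz B C).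

Let I := indep (enc f g lambda).
Let J := indep (enc g h mu).
Let U := join I J.
Let K := g @: setT.

Let mI : matroid I.
Proof. by apply: matroid_indep; case/(Exch_nzE f_inj g_inj fg): lambdaE. Qed.

Let mJ : matroid J.
Proof. by apply: matroid_indep; case/(Exch_nzE g_inj h_inj gh): muE. Qed.

Let mU : matroid U. Proof. exact: matroid_join. Qed.

Let basesI : bases I = enc f g lambda.
Proof. by apply: bases_indep; case/(Exch_nzE f_inj g_inj fg): lambdaE. Qed.

Let basesJ : bases J = enc g h mu.
Proof. by apply: bases_indep; case/(Exch_nzE g_inj h_inj gh): muE. Qed.

(** The set [B] is the target of [lambda] but the source of [mu], hence the complement on [Y] alone;
    what is missed is [Y :\: Y']. *)
Lemma codes_cap X Y' Y Z :
  (code f g X Y' :|: code g h Y Z) :&: K = g @: (Y' :|: ~: Y).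
Proof.
apply/setP=> x; apply/setIP/imsetP.
  case=> + /imsetP[b _ Dx]; subst x; case/setUP=> /setUP[] /imsetP[y yY] Dy.
  - by have := fg y b; rewrite Dy eqxx.
  - by exists y; rewrite // inE yY.
  - by exists y; rewrite // inE yY orbT.
  - by have := gh b y; rewrite Dy eqxx.
case=> b bY ->; split; last by apply: imset_f; rewrite inE.
by case/setUP: bY => bY; rewrite !inE (imset_f g bY) ?orbT.
Qed.

Lemma codes_diff X Y' Y Z :
  (code f g X Y' :|: code g h Y Z) :\: K = code f h X Z.
Proof.
have gK b : g b \in K by rewrite imset_f ?inE.
apply/setP=> x; apply/setDP/setUP.
  case=> + xK; case/setUP=> /setUP[] xS; try by [left | right];
  by case/imsetP: xS xK => b _ ->; rewrite gK.
move=> xS; split; first by case: xS => xS; rewrite !inE xS ?orbT.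
apply/imsetP=> -[b _ Dx]; subst x; case: xS => /imsetP[y _ Dy].
  by have := fg y b; rewrite Dy eqxx.
by have := gh b y; rewrite Dy eqxx.
Qed.

Lemma codes_overlap X Y' Y Z :
  code f g X Y' :&: code g h Y Z = g @: (Y' :\: Y).
Proof.
apply/setP=> x; apply/setIP/imsetP.
  case=> /setUP[] /imsetP[y yS ->] /setUP[] /imsetP[z zS] Dz.
  - by have := fg y z; rewrite Dz eqxx.
  - by have := fh y z; rewrite Dz eqxx.
  - by exists y; rewrite // inE yS andbT; move: zS; rewrite -(g_inj Dz) inE.
  - by have := gh y z; rewrite Dz eqxx.
case=> b /setDP[bY' bY] ->; have bnY : b \in ~: Y by rewrite inE.
by rewrite !inE (imset_f g bY') (imset_f g bnY) !orbT.
Qed.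

(** The first equation counts [B] as covered or missed. The second is inclusion-exclusion for two
    bases, whose cardinals are the ranks. *)
Lemma card_codes X Y' Y Z : (X, Y') \in lambda -> (Y, Z) \in mu ->
  let T := code f g X Y' :|: code g h Y Z in
  [/\ T \in U, #|Y :\: Y'| + #|T :&: K| = #|B|
    & #|Y' :\: Y| + #|T| = rank I setT + rank J setT].
Proof.
move=> lXY mYZ T.
have /setIdP[PI /eqP <-]: code f g X Y' \in bases I by rewrite basesI mem_enc.
have /setIdP[QJ /eqP <-]: code g h Y Z \in bases J by rewrite basesJ mem_enc.
split; first exact: imset2_f.
  rewrite codes_cap card_imset // -(cardsC (Y :\: Y')).
  by congr (_ + #|pred_of_set _|); apply/setP=> y; rewrite !inE negb_and negbK.
by rewrite -cardsUI codes_overlap card_imset // addnC.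
Qed.

Lemma card_codes_ge X Y' Y Z : (X, Y') \in lambda -> (Y, Z) \in mu ->
  #|B| <= #|Y :\: Y'| + rank U K /\
  rank I setT + rank J setT <= #|Y' :\: Y| + rank U setT.
Proof.
move=> lXY mYZ; have [TU <- <-] := card_codes lXY mYZ.
split; rewrite leq_add2l rank_ge ?subsetT ?subsetIr //.
by case: mU => _ dU _; apply: dU TU; apply: subsetIl.
Qed.

Lemma basis_codes T : T \in U -> #|T| = rank U setT ->
  exists X Y' Y Z, [/\ (X, Y') \in lambda, (Y, Z) \in mu
    & T = code f g X Y' :|: code g h Y Z].
Proof.
move=> TU rT; have [P [Q []]] := bases_join mI mJ TU rT.
rewrite basesI basesJ => /encP[X [Y' [lXY ->]]] /encP[Y [Z [mYZ ->]]] ->.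
by exists X, Y', Y, Z.
Qed.

(* A basis of U meeting K in a basis of K realizes the least k and the least l
   at the same time. *)
Lemma optimal_codes : exists X Y' Y Z, [/\ (X, Y') \in lambda, (Y, Z) \in mu,
  #|Y :\: Y'| + rank U K = #|B|
  & #|Y' :\: Y| + rank U setT = rank I setT + rank J setT].
Proof.
have [W [WU WK rW]] := rank_attained K mU.
have [T [TU WT _ rT]] := rank_extend mU WU (subsetT W).
have [X [Y' [Y [Z [lXY mYZ DT]]]]] := basis_codes TU rT.
exists X, Y', Y, Z; split=> //.
  have [geB _] := card_codes_ge lXY mYZ.
  have [_ cB _] := card_codes lXY mYZ; apply/eqP; rewrite eqn_leq geB andbT.
  by rewrite -cB leq_add2l -rW subset_leq_card // -DT subsetI WT.
by have [_ _ <-] := card_codes lXY mYZ; rewrite -DT rT.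
Qed.

Lemma comp_klP k l p : reflect
  (exists Y Y', [/\ (p.1, Y') \in lambda, (Y, p.2) \in mu,
     #|Y :\: Y'| = k & #|Y' :\: Y| = l]) (p \in comp_kl k l lambda mu).
Proof.
rewrite inE; apply: (iffP existsP) => -[Y].
  by case/existsP=> Y' /and4P[lY mY /eqP<- /eqP<-]; exists Y, Y'.
case=> Y' [lY mY <- <-]; exists Y; apply/existsP; exists Y'.
by rewrite lY mY !eqxx.
Qed.

Lemma comp_atP m p : reflect
  (exists Y Y', [/\ (p.1, Y') \in lambda, (Y, p.2) \in mu
     & #|Y :\: Y'| + #|Y' :\: Y| = m]) (p \in comp_at m lambda mu).
Proof.
rewrite inE; apply: (iffP existsP) => -[Y].
  by case/existsP=> Y' /and3P[lY mY /eqP<-]; exists Y, Y'; rewrite card_symdiff.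
case=> Y' [lY mY <-]; exists Y; apply/existsP; exists Y'.
by rewrite lY mY card_symdiff eqxx.
Qed.

(** By [card_codes_ge] the two cardinals are bounded below separately, and [optimal_codes] attains
    both bounds at once. Hence the least sum is [k + l], and only the pair [(k, l)] achieves it. *)
Lemma lax_type_exists : exists k l,
  [/\ k + rank U K = #|B|, l + rank U setT = rank I setT + rank J setT,
      forall t, is_type lambda mu t <-> t = (k, l)
    & lax_comp lambda mu = comp_kl k l lambda mu].
Proof.
have [X [Y' [Y [Z [lXY mYZ eqk eql]]]]] := optimal_codes.
set k := #|Y :\: Y'| in eqk; set l := #|Y' :\: Y| in eql.
have ge_kl X1 Y1' Y1 Z1 : (X1, Y1') \in lambda -> (Y1, Z1) \in mu ->
    k <= #|Y1 :\: Y1'| /\ l <= #|Y1' :\: Y1|.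
  by move=> l1 m1; have [] := card_codes_ge l1 m1; rewrite -eqk -eql !leq_add2r.
have lam0 : lambda != set0 by case/setD1P: lambdaE.
have mu0 : mu != set0 by case/setD1P: muE.
have [deg0 deg_min] := lax_degreeP lam0 mu0.
have deg : lax_degree lambda mu = k + l.
  apply/eqP; rewrite eqn_leq; apply/andP; split.
    apply: deg_min; apply/set0Pn; exists (X, Z); apply/comp_atP.
    by exists Y, Y'.
  case/set0Pn: deg0 => p /comp_atP[Y1 [Y1' [l1 m1 <-]]].
  by have [] := ge_kl _ _ _ _ l1 m1; apply: leq_add.
have sub_kl k1 l1 p : k1 + l1 = k + l -> p \in comp_kl k1 l1 lambda mu ->
    (k1, l1) = (k, l).
  move=> eq_kl /comp_klP[Y1 [Y1' [lY mY eqk1 eql1]]].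
  have [lek lel] := ge_kl _ _ _ _ lY mY; rewrite eqk1 in lek; rewrite eql1 in lel.
  by congr pair; lia.
exists k, l; split=> //.
  case=> k1 l1; rewrite /is_type deg /=; split.
    by case=> eq_kl /eqP/set0Pn[p]; apply: sub_kl.
  case=> -> ->; split=> //; apply/eqP/set0Pn; exists (X, Z).
  by apply/comp_klP; exists Y, Y'.
apply/setP=> p; rewrite /lax_comp deg; apply/comp_atP/comp_klP.
  case=> Y1 [Y1' [lY mY eq_kl]]; exists Y1, Y1'.
  have [] : (#|Y1 :\: Y1'|, #|Y1' :\: Y1|) = (k, l).
    by apply: (sub_kl _ _ p) => //; apply/comp_klP; exists Y1, Y1'.
  by split.
by case=> Y1 [Y1' [lY mY <- <-]]; exists Y1, Y1'.
Qed.

Lemma has_definite_type_Exch : has_definite_type lambda mu.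
Proof.
have [k [l [_ _ typeE _]]] := lax_type_exists.
by exists (k, l); split=> [|t /typeE //]; apply/typeE.
Qed.

(** These rank formulas reduce additivity of types to linear arithmetic. *)
Lemma lax_type_rank :
  (lax_type lambda mu).1 + rank U K = #|B| /\
  (lax_type lambda mu).2 + rank U setT = rank I setT + rank J setT.
Proof.
have [k [l [eqk eql typeE _]]] := lax_type_exists.
by have /typeE-> := lax_typeP has_definite_type_Exch.
Qed.

(** Having type [(k, l)] means that the union of the two codes is a basis of [U] meeting [K] in a
    basis of [K]; removing [K] from such a set gives exactly the bases of the contraction. *)
Lemma enc_lax_comp : enc f h (lax_comp lambda mu) = bases (contract U K).
Proof.
have [k [l [eqk eql _ ->]]] := lax_type_exists.
have rkC := rank_contractT K mU; case: (mU) => _ dU _.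
apply/setP=> P; apply/encP/setIdP.
  case=> X [Z [/comp_klP[Y [Y' [lXY mYZ eqk1 eql1]]] ->]].
  have [TU cB cT] := card_codes lXY mYZ; rewrite -(codes_diff X Y' Y Z).
  move: TU cB cT; set T := _ :|: _ => TU cB cT.
  have cTK : #|T :&: K| = rank U K by lia.
  split.
    apply/contractP; split; first exact: disjoint_setD.
    exists (T :&: K); rewrite subsetIr setUC setID; split=> //.
    by apply: dU TU; apply: subsetIl.
  by apply/eqP; have := cardsID K T; lia.
case=> /contractP[dP [W [WU WK rW PWU]]] /eqP rP.
(* A basis of the contraction together with a basis of [K] is a basis of [U], so [basis_codes]
   splits it into two codes. *)
have cT : #|P :|: W| = rank U setT.
  by rewrite card_disjointU ?rP ?rW //; apply: disjointWr dP.
have [X [Y' [Y [Z [lXY mYZ DT]]]]] := basis_codes PWU cT.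
have DP : P = (P :|: W) :\: K.
  move: WK; rewrite -setD_eq0 setDUl => /eqP->.
  by rewrite setU0; apply/esym/setDidPl.
have DW : W = (P :|: W) :&: K.
  by rewrite setIUl (disjoint_setI0 dP) set0U (setIidPl _).
exists X, Z; rewrite -(codes_diff X Y' Y Z) -DT -DP; split=> //.
apply/comp_klP; exists Y, Y'; have [_] := card_codes lXY mYZ.
by rewrite -DT -DW; split=> //=; lia.
Qed.

Lemma lax_comp_Exch : lax_comp lambda mu \in Exch_nz A C.
Proof.
apply/(Exch_nzE f_inj h_inj fh); rewrite enc_lax_comp.
have mC := matroid_contract K mU.
by split; [apply: bases_neq0 | apply: bases_exchange].
Qed.

Lemma indep_lax_comp : indep (enc f h (lax_comp lambda mu)) = contract U K.
Proof. by rewrite enc_lax_comp indep_bases //; apply: matroid_contract. Qed.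

End LaxCompositionMatroid.

(** * Definite type, associativity and additivity of types *)

Theorem theorem6p4 (A B C D : finType)
  (lambda : {set {set A} * {set B}})
  (mu : {set {set B} * {set C}})
  (nu : {set {set C} * {set D}})
  (hlambda : lambda \in Exch_nz A B)
  (hmu : mu \in Exch_nz B C)
  (hnu : nu \in Exch_nz C D) :
  (has_definite_type lambda mu /\ lax_comp lambda mu \in Exch_nz A C) /\
  lax_comp (lax_comp lambda mu) nu = lax_comp lambda (lax_comp mu nu) /\
  (int_pair (lax_type (lax_comp lambda mu) nu) + int_pair (lax_type lambda mu)
   = int_pair (lax_type mu nu) + int_pair (lax_type lambda (lax_comp mu nu)))%R.
Proof.
pose E : finType := ((A + B) + (C + D))%type.
pose a (x : A) : E := inl (inl x); pose b (x : B) : E := inl (inr x).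
pose c (x : C) : E := inr (inl x); pose d (x : D) : E := inr (inr x).
have a_inj : injective a by move=> x y [].
have b_inj : injective b by move=> x y [].
have c_inj : injective c by move=> x y [].
have d_inj : injective d by move=> x y [].
have ab x y : a x != b y by [].
have ac x y : a x != c y by [].
have ad x y : a x != d y by [].
have bc x y : b x != c y by [].
have bd x y : b x != d y by [].
have cd x y : c x != d y by [].
have hlm := lax_comp_Exch a_inj b_inj c_inj ab bc ac hlambda hmu.
have hmn := lax_comp_Exch b_inj c_inj d_inj bc cd bd hmu hnu.
split.
  by split=> //; apply: (has_definite_type_Exch a_inj b_inj c_inj ab bc ac).
set Il := indep (enc a b lambda); set Im := indep (enc b c mu).
set In := indep (enc c d nu); set KB := b @: setT; set KC := c @: setT.
have mIl : matroid Il.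
  by apply: matroid_indep; case/(Exch_nzE a_inj b_inj ab): hlambda.
have mIm : matroid Im.
  by apply: matroid_indep; case/(Exch_nzE b_inj c_inj bc): hmu.
have mIn : matroid In.
  by apply: matroid_indep; case/(Exch_nzE c_inj d_inj cd): hnu.
have offB P : P \in In -> [disjoint P & KB].
  by move/indep_enc_off; apply=> x; apply/imsetP=> -[].
have offC P : P \in Il -> [disjoint P & KC].
  by move/indep_enc_off; apply=> x; apply/imsetP=> -[].
have dBC : [disjoint KB & KC].
  by apply/pred0P=> x /=; apply/negP=> /andP[/imsetP[y _ ->] /imsetP[]].
have dCB : [disjoint KC & KB] by rewrite disjoint_sym.
have mlm := matroid_join mIl mIm; have mmn := matroid_join mIm mIn.
(* The union of all three matroids. [In] avoids [KB] and [Il] avoids [KC], so each partial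
   composition followed by a union is a contraction of [V]. *)
pose V := join (join Il Im) In; have mV : matroid V by apply: matroid_join.
have Vlm : join (contract (join Il Im) KB) In = contract V KB.
  by rewrite [RHS]contract_join.
have VE : V = join (join Im In) Il by rewrite /V -joinA joinC.
have Vmn : join Il (contract (join Im In) KC) = contract V KC.
  by rewrite VE [RHS]contract_join // joinC.
have rkB : rank (join Il Im) KB = rank V KB by rewrite [RHS]rank_join_off.
have rkC : rank (join Im In) KC = rank V KC.
  by rewrite VE [RHS]rank_join_off.
have Ilm := indep_lax_comp a_inj b_inj c_inj ab bc ac hlambda hmu.
have Imn := indep_lax_comp b_inj c_inj d_inj bc cd bd hmu hnu.
rewrite -/Il -/Im -/In -/KB -/KC in Ilm Imn.
split.
  apply: (enc_inj a_inj d_inj ad).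
  rewrite (enc_lax_comp a_inj c_inj d_inj ac cd ad hlm hnu) Ilm Vlm.
  rewrite (enc_lax_comp a_inj b_inj d_inj ab bd ad hlambda hmn) Imn Vmn.
  (* Both sides are the bases of the contraction of [V] by [KB :|: KC]. *)
  by rewrite !contract_contract // setUC.
have [k1 l1] := lax_type_rank a_inj b_inj c_inj ab bc ac hlambda hmu.
have [k2 l2] := lax_type_rank b_inj c_inj d_inj bc cd bd hmu hnu.
have [] := lax_type_rank a_inj c_inj d_inj ac cd ad hlm hnu.
have [] := lax_type_rank a_inj b_inj d_inj ab bd ad hlambda hmn.
rewrite Ilm Imn -/Il -/Im -/In -/KB -/KC Vlm Vmn => k3 l3 k4 l4.
rewrite -/Il -/Im -/In -/KB -/KC in k1 l1 k2 l2.
have rBC := rank_contract mV dBC; have rCB := rank_contract mV dCB.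
rewrite setUC in rCB.
have rB := rank_contractT KB mV; have rC := rank_contractT KC mV.
have rlm := rank_contractT KB mlm; have rmn := rank_contractT KC mmn.
(* On both sides the first entries add up to [#|B| + #|C|] minus the rank of [KB :|: KC] in [V], and
   the second to the sum of the ranks of [Il], [Im] and [In] minus that of [V]. *)
rewrite /int_pair; congr pair; rewrite -!PoszD; congr Posz; lia.
Qed.
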